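(* For every finite graph $H$, there is a hereditary weakly sparse class $\mathcal C_H$ of finite graphs of unbounded treewidth such that the subclass $\{G \in \mathcal C_H : G \text{ is } H\text{-free}\}$ has bounded treewidth.
   Context: A graph $G$ is $H$-free if $H$ is not isomorphic to an induced subgraph of $G$. A class of graphs is hereditary if it is closed under taking induced subgraphs. A class is weakly sparse if there is a finite integer $t$ such that no graph of the class contains the complete bipartite graph $K_{t,t}$ as a (not necessarily induced) subgraph. A class has bounded (resp. unbounded) treewidth if the treewidths of its members are (resp. are not) bounded by a constant. *)

(* Defs.v *)
From mathcomp Require Import all_boot.
Set Implicit Arguments. Unset Strict Implicit. Unset Printing Implicit Defensive.

Record graph := Graph {
  gV :> finType;
  gE : rel gV;
  gE_sym : symmetric gE;
  gE_irr : irreflexive gE }.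

Definition induced_sub (G' G : graph) : Prop :=
  exists f : gV G' -> gV G, injective f /\ forall x y : gV G', @gE G' x y = @gE G (f x) (f y).

Definition Hfree (H G : graph) : Prop := ~ induced_sub H G.

Definition graph_class := graph -> Prop.

Definition hereditary (C : graph_class) : Prop :=
  forall G G' : graph, C G -> induced_sub G' G -> C G'.

Definition has_Ktt (G : graph) (t : nat) : Prop :=
  exists (a b : 'I_t -> G), injective a /\ injective b /\
    (forall i j, a i != b j) /\ (forall i j, @gE G (a i) (b j)).

Definition weakly_sparse (C : graph_class) : Prop :=
  exists t : nat, forall G, C G -> ~ has_Ktt G t.

(* Trees: symmetric irreflexive, connected, no cycle (empty tree allowed, only for the empty graph). *)
Definition is_tree (T : finType) (eT : rel T) : Prop :=
  symmetric eT /\ irreflexive eT /\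
  (forall x y : T, connect eT x y) /\
  (forall s : seq T, uniq s -> 3 <= size s -> ~~ cycle eT s).

Definition tree_decomposition (G : graph) (T : finType) (eT : rel T)
    (B : T -> {set G}) : Prop :=
  is_tree eT /\
  (forall v : G, exists t : T, v \in B t) /\
  (forall u v : G, @gE G u v -> exists t : T, (u \in B t) && (v \in B t)) /\
  (forall (v : G) (t1 t2 : T), v \in B t1 -> v \in B t2 ->
     connect [rel a b | [&& eT a b, v \in B a & v \in B b]] t1 t2).

Definition tw_le (G : graph) (k : nat) : Prop :=
  exists (T : finType) (eT : rel T) (B : T -> {set G}),
    tree_decomposition eT B /\ forall t, #|B t| <= k.+1.

Definition bounded_tw (C : graph_class) : Prop :=
  exists k : nat, forall G, C G -> tw_le G k.

(* Main.v *)
Require Import Defs.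
From mathcomp Require Import all_boot zify.
Set Implicit Arguments. Unset Strict Implicit. Unset Printing Implicit Defensive.

(** The graphs are layered wheels. Take the infinite binary forest whose node at
    level [l] and position [x] has parent [(l-1, x/2)], join consecutive nodes of
    each level, and let each node carry a short bag of ancestors, only ever
    joining a node to elements of its bag. An even child inherits the bag of its
    parent; an odd child moreover gets the parent itself (and starts again from
    the empty bag if this is too much). A node with [i] elements in its bag is
    joined to them as the [i]-th vertex of [H] is to the previous ones, so that a
    full bag whose nodes are all kept is an induced copy of [H].

    Any two levels are adjacent, so contracting levels gives large clique minors,
    while each node has boundedly many neighbours on its own and upper levels,
    which excludes a large complete bipartite subgraph.

    Let [X] be an induced subgraph without [H]. From every node descends a fence:
    go to the even child off [X] and to the odd child on [X]. Each node of [X] met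
    by the fence enters the bag, so [H]-freeness bounds the number of these nodes.
    The part of [X] strictly between the fences of two consecutive nodes of a
    level is separated from the rest by the two fences and two bags. The fences of
    the next level cut it into at most three parts of the same kind, and this
    recursion is a tree decomposition of bounded width. *)

(** * Treewidth: clique minors and running-intersection sequences *)

Section CliqueMinor.

(* The orbit of [x] ends in a cycle of the tree, which has length two. *)
Lemma fun_two_cycle (T : finType) (eT : rel T) (f : T -> T) (x : T) :
  is_tree eT -> (forall t, eT t (f t)) -> exists y, f (f y) = y.
Proof.
move=> [_ [irr [_ acyc]]] ef.
have /trajectP [i lt_i eqi] := looping_order f x.
have [y [p [p_gt0 Uy fpy]]] : exists y p, [/\ 0 < p, uniq (traject f y p) & iter p f y = y].
  exists (iter i f x), (order f x - i); split; first by rewrite subn_gt0.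
    have := orbit_uniq f x; rewrite /orbit -{1}(subnKC (ltnW lt_i)) trajectD cat_uniq.
    by case/and3P.
  by rewrite -iterD subnK // ltnW.
have path_f : forall n z, path eT z (traject f (f z) n).
  by elim=> //= n IH z; rewrite ef IH.
have cyc : cycle eT (traject f y p).
  case: p p_gt0 fpy {Uy} => // p _ fpy; rewrite trajectS /=.
  have -> : rcons (traject f (f y) p) y = traject f (f y) p.+1.
    by rewrite trajectSr -iterSr fpy.
  exact: path_f.
have p_lt3 : p < 3.
  rewrite ltnNge; apply/negP => p3.
  by have := acyc _ Uy; rewrite size_traject cyc => /(_ p3).
case: p p_gt0 p_lt3 fpy {Uy cyc} => [|[|[|]]] //= _ _ fy.
  by have := ef y; rewrite fy irr.
by exists y.
Qed.

(** Neither path uses the edge between [t] and [t'], so joined at [s] and shortened they would close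
    a cycle with it. *)
Lemma tree_edge_bridge (T : finType) (eT : rel T) (t t' s : T) :
  is_tree eT -> eT t t' ->
  connect [rel a b | [&& eT a b, a != t & b != t]] t' s ->
  connect [rel a b | [&& eT a b, a != t' & b != t']] t s -> False.
Proof.
move=> [sym [irr [_ acyc]]] ett c1 c2.
pose e' := [rel a b | [&& eT a b, (a, b) != (t, t') & (a, b) != (t', t)]].
have sub_e' u : u \in [:: t; t'] ->
    subrel (connect [rel a b | [&& eT a b, a != u & b != u]]) (connect e').
  move=> ut; apply: connect_sub => a b /= /and3P [eab au bu]; apply: connect1.
  rewrite /= eab !xpair_eqE /=.
  by move: ut; rewrite !inE => /orP [] /eqP <-;
    rewrite (negbTE au) (negbTE bu) /= andbF.
have sym' : connect_sym e'.
  apply: sym_connect_sym => a b /=; rewrite sym; congr andb.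
  by rewrite !xpair_eqE andbC [(a == t) && _]andbC [(a == t') && _]andbC.
have : connect e' t' t.
  apply: (connect_trans (sub_e' t _ _ _ c1)); first by rewrite !inE eqxx.
  by rewrite sym'; apply: (sub_e' t' _ _ _ c2); rewrite !inE eqxx orbT.
case/connectP => p0 p0p p0l.
move: p0l; case/shortenP: p0p => p pp Up _ lastp.
have ppT : path eT t' p by apply: sub_path pp => a b /= /andP [].
case: p pp Up lastp ppT => [|a [|b p]] pp Up lastp ppT.
- by move: ett; rewrite lastp irr.
- by move: pp; rewrite /= lastp /= eqxx andbF /= andbF.
have /negP := acyc _ Up isT; apply.
move: ppT lastp => /= /andP [-> /andP [-> ppT]] lastp.
by rewrite rcons_path ppT -lastp ett.
Qed.

Variables (G : graph) (n : nat) (lev : G -> 'I_n).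

(** The levels are the branch sets of a clique minor. The tree nodes whose bags meet a given level
    form a subtree, and any two of these subtrees intersect, so some bag meets all [n] levels. *)
Lemma clique_minor_tw (k : nat) :
  (forall u v, lev u = lev v -> connect [rel a b | gE a b && (lev a == lev b)] u v) ->
  (forall i, exists u, lev u = i) ->
  (forall i j, i != j -> exists u v, [/\ lev u = i, lev v = j & gE u v]) ->
  tw_le G k -> n <= k.+1.
Proof.
move=> lev_conn lev_ne lev_adj [T [eT [B [[tT [Bv [Be Bc]]] Bk]]]].
pose S i t := [exists v, (lev v == i) && (v \in B t)].
have S_adj i j : exists t, S i t && S j t.
  have [<-|/lev_adj] := eqVneq i j.
    have [u ui] := lev_ne i; have [t ut] := Bv u.
    by exists t; rewrite andbb; apply/existsP; exists u; rewrite ui eqxx.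
  case=> u [v [ui vj /Be [t /andP [ut vt]]]]; exists t.
  by apply/andP; split; apply/existsP; [exists u|exists v]; rewrite ?ui ?vj eqxx.
have S_conn i a b : S i a -> S i b -> connect [rel a b | [&& eT a b, S i a & S i b]] a b.
  have same v a' b' : lev v = i -> v \in B a' -> v \in B b' ->
      connect [rel a b | [&& eT a b, S i a & S i b]] a' b'.
    move=> vi va vb; have := Bc _ _ _ va vb; apply: connect_sub => c d /= /and3P [cd vc vd].
    by apply/connect1/and3P; split=> //; apply/existsP; exists v; rewrite vi eqxx.
  case/existsP => u /andP [/eqP ui ua] /existsP [v /andP [/eqP vi vb]].
  (* Each edge of a path inside the level lies in a common bag, which links the subtrees of its two
     ends. *)
  have [p pp ev] := connectP (lev_conn u v (etrans ui (esym vi))); rewrite {v}ev in vi vb.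
  elim: p u a ui ua pp vi vb => [|w p IH] u a ui ua /=; first by move=> *; apply: (same u).
  case/andP=> /andP [/Be [t /andP [ut wt]] /eqP uw] pp vi vb.
  by apply: connect_trans (same u a t ui ua ut) _; apply: (IH w); rewrite -?uw.
case: (boolP [exists t, [forall i, S i t]]) => [/existsP [t /forallP St]|noSt].
  apply: leq_trans (Bk t); rewrite -{1}(card_ord n).
  apply: leq_trans (leq_imset_card lev _); apply/subset_leq_card/subsetP => i _.
  by have /existsP [v /andP [/eqP <- vt]] := St i; apply: imset_f.
case: (posnP n) => [-> //|n_gt0]; exfalso.
have [u _] := lev_ne (Ordinal n_gt0); have [t0 _] := Bv u.
(* Helly property: if no bag meets every level, each tree node [t] points to its
   neighbour towards a level missing at [t]; two nodes pointing at each other then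
   separate two levels. *)
have step t : exists p : T * 'I_n,
  eT t p.1 /\ forall s, S p.2 s -> connect [rel a b | [&& eT a b, a != t & b != t]] p.1 s.
  move: noSt; rewrite negb_exists => /forallP /(_ t); rewrite negb_forall => /existsP [i nSt].
  have [s /andP [Ss _]] := S_adj i i.
  have [_ [_ [/(_ t s) /connectP [p0 pp0 ps0] _]]] := tT.
  move: ps0; case/shortenP: pp0 => p pp Up _ ps.
  case: p pp Up ps => [|t' p] /= pp Up ps; first by rewrite -ps Ss in nSt.
  exists (t', i); case/andP: pp => ett' pp; split=> //= s' Ss'.
  apply: (@connect_trans _ _ s).
    apply/connectP; exists p => //.
    case/andP: Up; rewrite inE negb_or => /andP [tt' tp] _.
    elim: p t' tt' tp pp {ps ett'} => //= b p IH a ta.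
    rewrite inE negb_or => /andP [tb tp] /andP [-> /(IH _ tb tp) ->].
    by rewrite eq_sym ta eq_sym tb.
  have := S_conn _ _ _ Ss Ss'; apply: connect_sub => a b /= /and3P [eab Sa Sb].
  apply/connect1; rewrite /= eab /=.
  by apply/andP; split; [move: Sa|move: Sb]; apply: contraTneq => ->.
have [F FP] := fin_all_exists step.
have [y fy] := fun_two_cycle t0 tT (fun t => (FP t).1).
have [s /andP [s1 s2]] := S_adj (F y).2 (F (F y).1).2.
apply: (@tree_edge_bridge T eT y (F y).1 s tT); first by have [] := FP y.
  by have [_] := FP y; apply.
by have [_ /(_ _ s2)] := FP (F y).1; rewrite fy.
Qed.

End CliqueMinor.

(** * Gluing of decompositions given as sequences of bags *)

Section JoinTree.
Variables (G : graph) (K : nat).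
Implicit Types (b s : seq {set G}) (V W Q : {set G}).

(* The bags are listed leaves first, so that the last one is the root. *)
Fixpoint join_tree b : Prop :=
  if b is B :: b' then
    (b' = [::] \/ exists2 P, P \in b' & forall C, C \in b' -> B :&: C \subset P) /\ join_tree b'
  else True.

(** A tree decomposition of the subgraph induced on [V], with a designated root bag [W] along which
    it can be glued to others. Here [K] bounds the size of a bag, not the width. *)
Definition rooted_dec V W : Prop :=
  exists s, [/\ join_tree (rcons s W),
    forall B, B \in rcons s W -> #|B| <= K /\ B \subset V,
    forall v, v \in V -> exists2 B, B \in rcons s W & v \in B
  & forall u v, u \in V -> v \in V -> gE u v ->
      exists2 B, B \in rcons s W & (u \in B) && (v \in B)].

Lemma rooted_dec_base W : #|W| <= K -> rooted_dec W W.
Proof.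
move=> WK; exists [::]; split=> /=; first by split=> //; left.
- by move=> B; rewrite inE => /eqP ->.
- by move=> v vW; exists W; rewrite ?inE.
by move=> u v uW vW _; exists W; rewrite ?inE ?uW.
Qed.

(** The second decomposition is hung below the root [Q] by its own root [W1]. The last hypothesis
    makes [V1] and [V] meet only in [W1] and keeps the edges at [V1 :\: W1] inside [V1]. *)
Lemma rooted_dec_add V Q V1 W1 :
  rooted_dec V Q -> rooted_dec V1 W1 -> W1 \subset Q ->
  (forall u, u \in V1 -> u \notin W1 -> u \notin V /\ forall v, gE u v -> v \in V1) ->
  rooted_dec (V :|: V1) Q.
Proof.
move=> [s [js bs cs es]] [s1 [js1 bs1 cs1 es1]] W1Q fresh.
exists (rcons s1 W1 ++ s); rewrite rcons_cat; split.
- have W1s1 : W1 \in rcons s1 W1 by rewrite mem_rcons inE eqxx.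
  have V1V (B C : {set G}) : B \subset V1 -> C \subset V -> B :&: C \subset W1.
    move=> /subsetP BV1 /subsetP CV; apply/subsetP => v; rewrite inE => /andP [/BV1 v1 /CV v2].
    by apply/negPn/negP => /(fresh _ v1) []; rewrite v2.
  have bV B : B \in rcons s Q -> B \subset V by move/bs => [].
  have b1V B : B \in rcons s1 W1 -> B \subset V1 by move/bs1 => [].
  elim: s1 js1 b1V {bs1 cs1 es1 W1s1} => [|B s1 IH] /=.
    move=> _ bV1; split=> //; right; exists Q; first by rewrite mem_rcons inE eqxx.
    by move=> C _; apply: subset_trans W1Q; apply: subsetIl.
  move=> [par js1] b1V; split; last first.
    by apply: IH => // C Cs1; apply: b1V; rewrite inE Cs1 orbT.
  right; case: par => [e|[P Ps1 PP]]; first by case: (s1) e.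
  exists P; first by rewrite mem_cat Ps1.
  move=> C; rewrite mem_cat => /orP [/PP //|/bV CV].
  have W1s1 : W1 \in rcons s1 W1 by rewrite mem_rcons inE eqxx.
  apply: subset_trans (PP _ W1s1); rewrite subsetI subsetIl.
  by apply: V1V CV; apply: b1V; rewrite inE eqxx.
- move=> B; rewrite mem_cat => /orP [/bs1 [-> BV1]|/bs [-> BV]]; split=> //.
    exact: subset_trans BV1 (subsetUr _ _).
  exact: subset_trans BV (subsetUl _ _).
- move=> v; rewrite inE => /orP [/cs [B]|/cs1 [B]] Bs vB; exists B; rewrite // mem_cat Bs //.
  by rewrite orbT.
move=> u v uV vV uv.
have h1 : u \in V1 -> v \in V1 -> exists2 B, B \in rcons s1 W1 ++ rcons s Q & (u \in B) && (v \in B).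
  by move=> u1 v1; have [B Bs uvB] := es1 _ _ u1 v1 uv; exists B => //; rewrite mem_cat Bs.
have h2 : u \in V -> v \in V -> exists2 B, B \in rcons s1 W1 ++ rcons s Q & (u \in B) && (v \in B).
  by move=> u1 v1; have [B Bs uvB] := es _ _ u1 v1 uv; exists B => //; rewrite mem_cat Bs orbT.
have W1V : W1 \subset V.
  by apply: subset_trans W1Q _; have [] := bs Q; rewrite ?mem_rcons ?inE ?eqxx.
have [u0|u0] := boolP (u \in V1 :\: W1).
  by move: u0; rewrite inE => /andP [uW u1]; apply: h1 => //; have [_] := fresh _ u1 uW; apply.
have [v0|v0] := boolP (v \in V1 :\: W1).
  move: v0; rewrite inE => /andP [vW v1]; apply: h1 => //; have [_] := fresh _ v1 vW; apply.
  by rewrite gE_sym.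
apply: h2.
- by case/setUP: uV => // u1; apply: (subsetP W1V); move: u0; rewrite inE u1 andbT negbK.
- by case/setUP: vV => // v1; apply: (subsetP W1V); move: v0; rewrite inE v1 andbT negbK.
Qed.

(** The smaller bag is added as a new root above [Q]. *)
Lemma rooted_dec_shrink V Q W : rooted_dec V Q -> W \subset Q -> rooted_dec V W.
Proof.
move=> [s [js bs cs es]] WQ; exists (rcons s Q).
have [QK QV] : #|Q| <= K /\ Q \subset V by apply: bs; rewrite mem_rcons inE eqxx.
have sub B : B \in rcons s Q -> B \in rcons (rcons s Q) W.
  by move=> Bs; rewrite mem_rcons inE Bs orbT.
split.
- elim: s js {bs cs es sub} => [|B s IH] /=.
    move=> _; do !split=> //; last by left.
    by right; exists W; rewrite ?inE // => C; rewrite inE => /eqP ->; apply: subsetIr.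
  move=> [par js]; split; last exact: IH.
  right; case: par => [e|[P Ps PP]]; first by case: (s) e.
  exists P; first by rewrite mem_rcons inE Ps orbT.
  move=> C; rewrite mem_rcons inE => /predU1P [->|]; last exact: PP.
  have Qs : Q \in rcons s Q by rewrite mem_rcons inE eqxx.
  exact: subset_trans (setIS _ WQ) (PP _ Qs).
- move=> B; rewrite mem_rcons inE => /predU1P [->|/bs //].
  by split; [apply: leq_trans (subset_leq_card WQ) QK|apply: subset_trans WQ QV].
- by move=> v /cs [B /sub Bs vB]; exists B.
by move=> u v uV vV uv; have [B /sub Bs uvB] := es _ _ uV vV uv; exists B.
Qed.

Lemma join_tree_par b : join_tree b -> forall i, i.+1 < size b -> exists j,
  [/\ i < j, j < size b & forall k, i < k < size b ->
    nth set0 b i :&: nth set0 b k \subset nth set0 b j].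
Proof.
elim: b => [//|B b IH] [par jb] [|i] /= lt_i.
  case: par => [e|[P Pb PP]]; first by rewrite e in lt_i.
  exists (index P b).+1; split=> //; first by rewrite ltnS index_mem.
  by case=> // k /= lt_k; rewrite nth_index //; apply/PP/mem_nth.
have [j [ij jb' jP]] := IH jb i lt_i.
by exists j.+1; split=> // -[|k] //= /jP.
Qed.

(** The guards discard the value of [par] at the last index, the root, which has no parent. *)
Definition parent_rel n (par : 'I_n -> 'I_n) : rel 'I_n :=
  fun i j => ((i < j) && (par i == j)) || ((j < i) && (par j == i)).

(** Following parents leads to the last index. On a cycle, both neighbours of the smallest index are
    larger, hence both equal its parent, although they are distinct. *)
Lemma parent_tree n (par : 'I_n -> 'I_n) :
  (forall i : 'I_n, i.+1 < n -> i < par i) -> is_tree (parent_rel par).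
Proof.
move=> parP; set e := parent_rel par.
have sym : symmetric e by move=> i j; rewrite /e /parent_rel /= orbC.
split=> //; split; first by move=> i; rewrite /e /parent_rel /= ltnn.
split.
  move=> i j.
  have csym : connect_sym e by apply: sym_connect_sym.
  have n0 : 0 < n by apply: leq_ltn_trans (ltn_ord i).
  have lt_last : n.-1 < n by rewrite prednK.
  have toL m (a : 'I_n) : n - a <= m -> connect e a (Ordinal lt_last).
    elim: m a => [|m IH] a am; first by have := ltn_ord a; lia.
    have [lt_a|ge_a] := ltnP a.+1 n.
      have pa := parP _ lt_a.
      apply: (@connect_trans _ _ (par a)); last by apply: IH; lia.
      by apply: connect1; rewrite /e /parent_rel /= pa eqxx.
    suff -> : a = Ordinal lt_last by apply: connect0.
    by apply: val_inj => /=; have := ltn_ord a; lia.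
  by apply: (connect_trans (toL _ i (leqnn _))); rewrite csym; apply: (toL _ j (leqnn _)).
move=> s Us s3; apply/negP => cs.
have [x xs xmin] : exists2 x, x \in s & forall y, y \in s -> x <= y.
  case: s s3 {Us cs} => // z s _.
  have zs : z \in z :: s by rewrite inE eqxx.
  by case: (arg_minnP (fun i : 'I_n => nat_of_ord i) zs) => x xs xmin; exists x.
have up y : e x y -> y \in s -> y = par x.
  by rewrite /e /parent_rel /= => /orP [/andP [_ /eqP]|/andP [yx _]] // /xmin; rewrite leqNgt yx.
have [i s' rs] := rot_to xs.
move: Us cs s3; rewrite -(rot_uniq i) -(rot_cycle i) -(size_rot i).
have ms y : (y \in s) = (y \in x :: s') by rewrite -rs mem_rot.
rewrite rs; case: s' ms {rs} => [|y [|z s']] ms //= Us cs _.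
have ey : y = par x by apply: up; [case/andP: cs|rewrite ms !inE eqxx orbT].
move: cs; rewrite rcons_path => /and3P [_ _ /andP [_ lx]].
have el : last z s' = par x.
  by apply: up; [rewrite sym|rewrite ms inE [_ \in y :: _]inE mem_last !orbT].
have yzs : y \in z :: s' by rewrite ey -el mem_last.
by case/and3P: Us => _ /negP [].
Qed.

Lemma rooted_dec_tw W : 0 < K -> rooted_dec setT W -> tw_le G K.-1.
Proof.
move=> K_gt0 [s [js bs cs es]]; move: (rcons s W) js bs cs es => {s W} b jb bb cb eb.
have parE (i : 'I_(size b)) : exists j : 'I_(size b), i.+1 < size b -> i < j /\
    forall k : 'I_(size b), i < k -> nth set0 b i :&: nth set0 b k \subset nth set0 b j.
  have [/(join_tree_par jb) [j [ij jb' jP]]|ge_i] := ltnP i.+1 (size b); last by exists i.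
  by exists (Ordinal jb') => _; split=> // k ik; apply: jP; rewrite ik /=.
have [par parP] := fin_all_exists parE.
have tT := parent_tree (fun i lt_i => (parP i lt_i).1).
exists 'I_(size b), (parent_rel par), (fun i : 'I_(size b) => nth set0 b i); split; last first.
  by move=> t; rewrite prednK //; have [] := bb _ (mem_nth set0 (ltn_ord t)).
have idx B : B \in b -> exists i : 'I_(size b), nth set0 b i = B.
  by rewrite -index_mem => lt; exists (Ordinal lt); rewrite nth_index -?index_mem.
split; first exact: tT.
split; first by move=> v; have [B /idx [i <-] vB] := cb v (in_setT _); exists i.
split.
  move=> u v uv; have [B /idx [i <-] uvB] := eb u v (in_setT _) (in_setT _) uv; by exists i.
move=> v t1 t2 v1 v2.
set e := rel_of_simpl _.
have csym : connect_sym e.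
  by apply: sym_connect_sym => i j; rewrite /e /parent_rel /= orbC; congr andb; rewrite andbC.
(* Let [m] be the last bag containing [v]. By running intersection, every other bag containing [v]
   has a parent containing [v], so all of them climb to [m]. *)
case: (@arg_maxnP _ t1 (fun i : 'I_(size b) => v \in nth set0 b i) (fun i => nat_of_ord i) v1) => m vm mmax.
have toM d (t : 'I_(size b)) : size b - t <= d -> v \in nth set0 b t -> connect e t m.
  elim: d t => [|d IH] t td vt; first by have := ltn_ord t; lia.
  have [<-|tm] := eqVneq t m; first exact: connect0.
  have lt_tm : t < m by rewrite ltn_neqAle tm; apply: mmax.
  have lt_t : t.+1 < size b by apply: leq_ltn_trans lt_tm (ltn_ord m).
  have [lt_p /(_ m lt_tm) /subsetP sub] := parP t lt_t.
  have vp : v \in nth set0 b (par t) by apply: sub; rewrite inE vt.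
  apply: (@connect_trans _ _ (par t)); last by apply: IH => //; lia.
  by apply: connect1; rewrite /e /parent_rel /= lt_p eqxx vt vp.
by apply: (connect_trans (toM _ t1 (leqnn _) v1)); rewrite csym; apply: toM (leqnn _) v2.
Qed.

End JoinTree.

(** * The layered wheel and its fences *)

Lemma iter_half_leq k x y : x <= y -> iter k half x <= iter k half y.
Proof. by elim: k => //= k IH /IH; apply: half_leq. Qed.

Section Fence.
Variable X : pred (nat * nat).
Implicit Types p : nat * nat.

Definition fnext p : nat * nat := (p.1.+1, p.2.*2 + X p).
Definition fence n p := iter n fnext p.

Lemma fence1 n p : (fence n p).1 = p.1 + n.
Proof. by elim: n => [|n IH] /=; rewrite ?addn0 // IH addnS. Qed.

Lemma half_fnext p : (fnext p).2./2 = p.2.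
Proof. by rewrite /= addnC half_bit_double. Qed.

(** A fence only descends to children, so taking parents runs back along it. *)
Lemma half_fence k n p : iter k half (fence (n + k) p).2 = (fence n p).2.
Proof.
by elim: k n => [|k IH] n; rewrite ?addn0 // addnS iterSr /fence iterS half_fnext IH.
Qed.

(** Doubling turns a gap of at least 1 into one of at least 2, which a shift by at most 1 cannot
    close: fences never cross. *)
Lemma fence_mono n l x y : x < y -> (fence n (l, x)).2 < (fence n (l, y)).2.
Proof.
move=> xy; elim: n => //= n IH; rewrite -!/(fence n _).
by case: (X _); case: (X _); lia.
Qed.

Lemma fence_leq n l x y : x <= y -> (fence n (l, x)).2 <= (fence n (l, y)).2.
Proof. by rewrite leq_eqVlt => /predU1P [->//|/(fence_mono n l)/ltnW]. Qed.

Lemma fenceSr n p : fence n.+1 p = fence n (fnext p).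
Proof. exact: iterSr. Qed.

End Fence.

Definition anc (p : nat * nat) i := (i, iter (p.1 - i) half p.2).

(** * Bags, adjacency, and the number of kept nodes on a fence *)

Section Wheel.
Variables (h : nat) (M : rel nat).
Hypothesis h_gt0 : 0 < h.
Implicit Types (p q : nat * nat).

(* A bag is given by the levels of its ancestors; [h] bounds its size. *)
Fixpoint bag l x : seq nat :=
  if l is l'.+1 then
    let s := bag l' x./2 in
    if odd x then if (size s).+1 < h then rcons s l' else [::] else s
  else [::].

Definition up p q :=
  [&& q.1 \in bag p.1 p.2, q.2 == iter (p.1 - q.1) half p.2
    & M (index q.1 (bag p.1 p.2)) (size (bag p.1 p.2))].

Definition horiz p q := (p.1 == q.1) && ((p.2.+1 == q.2) || (q.2.+1 == p.2)).

Definition wadj p q := [|| horiz p q, up p q | up q p].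

Lemma wadj_sym : symmetric wadj.
Proof. by move=> p q; rewrite /wadj /horiz eq_sym [in X in _ && X]orbC [up p q || _]orbC. Qed.

Lemma bag_lt l x i : i \in bag l x -> i < l.
Proof.
elim: l x => //= l IH x.
have {}IH : i \in bag l x./2 -> i < l.+1 by move/IH/leqW.
case: (odd x) => //; case: ifP => // _; rewrite mem_rcons inE => /predU1P [->|] //.
Qed.

Lemma size_bag l x : size (bag l x) < h.
Proof.
by elim: l x => //= l IH x; case: (odd x) => //; case: ifP => //; rewrite size_rcons.
Qed.

Lemma bag_uniq l x : uniq (bag l x).
Proof.
elim: l x => //= l IH x; case: (odd x) => //; case: ifP => // _.
rewrite rcons_uniq IH andbT; apply/negP => /bag_lt; by rewrite ltnn.
Qed.

(** A node is appended to the very bag it has itself, and further descent only appends or restarts;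
    hence the entries before it in a later bag are exactly its own bag. *)
Lemma bag_prefix m y i : i < size (bag m y) ->
  bag (nth 0 (bag m y) i) (iter (m - nth 0 (bag m y) i) half y) = take i (bag m y).
Proof.
elim: m y => //= m IH y.
have old : i < size (bag m y./2) ->
    bag (nth 0 (bag m y./2) i) (iter (m.+1 - nth 0 (bag m y./2) i) half y) =
    take i (bag m y./2).
  move=> lt_i; rewrite -IH //; have /bag_lt lt := mem_nth 0 lt_i.
  by rewrite subSn ?iterSr // ltnW.
case: (odd y) => //; case: ifP => // _; rewrite size_rcons ltnS leq_eqVlt nth_rcons.
case/predU1P => [->|lt_i].
  by rewrite ltnn eqxx subSnn /= -cats1 take_cat ltnn subnn cats0.
by rewrite lt_i old // -cats1 take_cat lt_i.
Qed.

(** Below level [l] only levels at least [l] are inserted, so a smaller entry was already present at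
    level [l]. *)
Lemma bag_anc l m y i : l <= m -> i < l -> i \in bag m y -> i \in bag l (iter (m - l) half y).
Proof.
elim: m y => [|m IH] y; first by case: l.
rewrite leq_eqVlt => /predU1P [-> _|]; first by rewrite subnn.
rewrite ltnS => lm il /=; rewrite subSn // iterSr => ib; apply: IH => //.
case: (odd y) ib => //; case: ifP => // _; rewrite mem_rcons inE => /predU1P [ei|//].
by rewrite ei ltnNge lm in il.
Qed.

(** Candidates for the neighbours whose level number is at most that of [p]. At position 0 the
    predecessor is [p] itself, harmless since only an upper bound on their number is wanted. *)
Definition down_nbrs p : seq (nat * nat) :=
  [:: (p.1, p.2.+1), (p.1, p.2.-1) & [seq (i, iter (p.1 - i) half p.2) | i <- bag p.1 p.2]].

Lemma size_down_nbrs p : size (down_nbrs p) <= h.+1.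
Proof. by rewrite /= size_map; have := size_bag p.1 p.2. Qed.

Lemma down_nbrsP p q : wadj p q -> q.1 <= p.1 -> q \in down_nbrs p.
Proof.
case: p q => [l x] [m y] /=; rewrite /wadj /horiz /up /= => adj ml; rewrite !inE.
case/or3P: adj.
- case/andP => /eqP <- /orP [] /eqP <-; rewrite ?eqxx ?orbT //.
- case/and3P => mb /eqP -> _; apply/orP; right; apply/orP; right.
  by apply/mapP; exists m.
- by case/and3P => /bag_lt; rewrite ltnNge ml.
Qed.

Variable X : pred (nat * nat).
Notation fnext := (fnext X).
Notation fence := (fence X).

Lemma bag_fnext p : bag (fnext p).1 (fnext p).2 =
  if X p then if (size (bag p.1 p.2)).+1 < h then rcons (bag p.1 p.2) p.1 else [::]
  else bag p.1 p.2.
Proof.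
by rewrite [LHS]/= addnC half_bit_double oddD odd_double addbF; case: (X p).
Qed.

Lemma anc_fnext p i : i <= p.1 -> anc (fnext p) i = anc p i.
Proof. by move=> ip; rewrite /anc /= subSn // iterSr addnC half_bit_double. Qed.

Lemma anc_self p : anc p p.1 = p.
Proof. by case: p => l x; rewrite /anc subnn. Qed.

Definition full_chain p :=
  [&& (size (bag p.1 p.2)).+1 == h, X p & all (fun i => X (anc p i)) (bag p.1 p.2)].

Hypothesis no_full_chain : forall p, ~~ full_chain p.

(** As long as the bag lies in [X], each node of [X] on the fence lengthens it by one: a restart
    would need a full chain. The bag size is thus a potential for the count. *)
Lemma count_fence_good n p : all (fun i => X (anc p i)) (bag p.1 p.2) ->
  count X (traject fnext p n) + size (bag p.1 p.2) < h.
Proof.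
elim: n p => [|n IH] p allX; first exact: size_bag.
have keep s : {subset s <= bag p.1 p.2} -> all (fun i => X (anc (fnext p) i)) s.
  move=> sub; apply/allP => i /sub ib; rewrite anc_fnext; first exact: (allP allX).
  by apply/ltnW/(bag_lt ib).
rewrite trajectS /=; have := IH (fnext p); rewrite bag_fnext.
have [Xp|] := boolP (X p); last by move=> _; apply; apply: keep.
case: ltnP => [_|ge_h _].
  rewrite size_rcons addnS add1n addSn; apply.
  by rewrite all_rcons keep // andbT anc_fnext // anc_self.
have := no_full_chain p; rewrite /full_chain Xp allX !andbT => /negP [].
by rewrite eqn_leq ge_h andbT size_bag.
Qed.

(* A fence restarts its bag at most once: afterwards the bag lies inside X. *)
Lemma count_fence n p : count X (traject fnext p n) + size (bag p.1 p.2) < h + h.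
Proof.
elim: n p => [|n IH] p; first by apply: ltn_addr; apply: size_bag.
rewrite trajectS /=; have := IH (fnext p); rewrite bag_fnext.
have := @count_fence_good n (fnext p); rewrite bag_fnext.
have [Xp|//] := boolP (X p).
case: ltnP => [_ _|_ /(_ isT) + _] /=; first by rewrite size_rcons addnS add1n addSn.
by have := size_bag p.1 p.2; lia.
Qed.

End Wheel.

(** All pieces are hung in turn below the root [Q]; their private parts [V i :\: W i] are pairwise
    disjoint, avoid [Q] and send no edge out of [V i]. *)
Lemma rooted_dec_star (G : graph) (K : nat) (I : eqType) (r : seq I)
    (V W : I -> {set G}) (Q : {set G}) :
  #|Q| <= K -> uniq r ->
  (forall i, i \in r -> rooted_dec K (V i) (W i)) ->
  (forall i, i \in r -> W i \subset Q) ->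
  (forall i u, i \in r -> u \in V i -> u \notin W i -> [/\ u \notin Q,
     forall j, j \in r -> j != i -> u \notin V j & forall v, gE u v -> v \in V i]) ->
  rooted_dec K (Q :|: \bigcup_(i <- r) V i) Q.
Proof.
move=> QK; elim: r => [|i r IH] /= Ur dec WQ fresh.
  by rewrite big_nil setU0; apply: rooted_dec_base.
case/andP: Ur => ir Ur; rewrite big_cons (setUC (V i)) setUA.
have ii : i \in i :: r by rewrite inE eqxx.
have sub j : j \in r -> j \in i :: r by move=> jr; rewrite inE jr orbT.
apply: rooted_dec_add (dec i ii) (WQ i ii) _.
  apply: IH => // [j /sub jr|j /sub jr|j u /sub jr uV uW]; [exact: dec|exact: WQ|].
  by have [uQ uj uN] := fresh j u jr uV uW; split=> // k /sub; apply: uj.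
move=> u uV uW; have [uQ uj uN] := fresh i u ii uV uW; split=> //.
rewrite inE negb_or uQ /=; elim: r ir sub {ii IH Ur dec WQ fresh} uj => [|j r IH] ir sub uj.
  by rewrite big_nil inE.
move: ir; rewrite inE negb_or => /andP [ij ir].
rewrite big_cons inE negb_or uj ?inE ?eqxx ?orbT 1?eq_sym //=.
apply: IH => // [k kr|k]; first by rewrite inE kr orbT.
by rewrite inE => /predU1P [->|kr] //; apply: uj; rewrite ?inE ?eqxx ?kr ?orbT.
Qed.

Lemma locate (g : nat -> nat) a b z : a <= b -> g a <= z < g b ->
  exists y, [/\ a <= y, y < b & g y <= z < g y.+1].
Proof.
move=> /subnKC <-; elim: (b - a) => [|d IH]; first by rewrite addn0; lia.
rewrite addnS => /andP [az zb]; have [zd|dz] := ltnP z (g (a + d)).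
  by have [|y [ay yd zy]] := IH; [rewrite az zd|exists y; split=> //; lia].
by exists (a + d); rewrite dz zb; split=> //; lia.
Qed.

(** * Upper bound on the treewidth *)

Section Embedded.
Variables (h : nat) (M : rel nat) (G : graph) (f : G -> nat * nat).
Hypothesis h_gt0 : 0 < h.
Hypothesis f_inj : injective f.
Hypothesis f_adj : forall u v, gE u v = wadj h M (f u) (f v).

(** The deepest vertex of the two sides would have [h.+2] neighbours on its own and upper levels,
    but there are at most [h.+1]. *)
Lemma no_Ktt : ~ has_Ktt G h.+2.
Proof.
case=> a [b [a_inj [b_inj [_ ab]]]].
have [i _ imax] := @arg_maxnP _ ord0 xpredT (fun i => (f (a i)).1) isT.
have [j _ jmax] := @arg_maxnP _ ord0 xpredT (fun i => (f (b i)).1) isT.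
have bound (c : 'I_h.+2 -> G) w : injective c -> (forall k, gE w (c k)) ->
    (forall k, (f (c k)).1 <= (f w).1) -> False.
  move=> c_inj wc le_w.
  have : #|'I_h.+2| <= size (down_nbrs h (f w)).
    rewrite cardE -(size_map (fun k => f (c k))); apply: uniq_leq_size.
      by rewrite map_inj_uniq ?enum_uniq // => k k' /f_inj /c_inj.
    by move=> _ /mapP [k _ ->]; apply: (down_nbrsP (M := M)); rewrite -?f_adj.
  by rewrite card_ord leqNgt ltnS size_down_nbrs.
have [le|/ltnW le] := leqP (f (b j)).1 (f (a i)).1.
  by apply: (bound b (a i)) => // k; apply: leq_trans le; apply: jmax.
apply: (bound a (b j)) => // k; first by rewrite gE_sym.
by apply: leq_trans le; apply: imax.
Qed.

Definition occupied : pred (nat * nat) := fun p => [exists v, f v == p].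
Notation X := occupied.
Notation fence := (fence X).
Notation fnext := (fnext X).
Notation bag := (bag h).

Lemma occupied_f v : X (f v). Proof. by apply/existsP; exists v. Qed.

Hypothesis no_full_chain : forall p, ~~ full_chain h X p.

Definition Fset p : {set G} := [set v | f v == fence ((f v).1 - p.1) p].
Definition Bset p : {set G} := [set v | ((f v).1 \in bag p.1 p.2) && (f v == anc p (f v).1)].
Definition Aset p := Fset p :|: Bset p.
Definition Wset l x := Aset (l, x) :|: Aset (l, x.+1).
Definition region l x : {set G} := [set v | (l <= (f v).1) &&
  ((fence ((f v).1 - l) (l, x)).2 < (f v).2 < (fence ((f v).1 - l) (l, x.+1)).2)].

Lemma card_Fset p : #|Fset p| <= h + h.
Proof.
(* Past [N] steps the fence is deeper than every vertex of [G]. *)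
pose N := (\max_(v : G) (f v).1).+1.
apply: (@leq_trans (count X (traject fnext p N))); last first.
  by apply/ltnW; apply: leq_trans (count_fence h_gt0 no_full_chain N p); rewrite ltnS leq_addr.
rewrite cardE -(size_map f) -size_filter; apply: uniq_leq_size.
  by rewrite map_inj_uniq ?enum_uniq.
move=> q /mapP [v]; rewrite mem_enum inE => /eqP fv ->.
rewrite mem_filter occupied_f; apply/trajectP; exists ((f v).1 - p.1) => //.
rewrite ltnS; apply: leq_trans (leq_subr _ _) _; exact: (leq_bigmax v).
Qed.

Lemma card_Aset p : #|Aset p| <= 3 * h.
Proof.
apply: leq_trans (leq_card_setU _ _) _.
suff : #|Bset p| <= h by have := card_Fset p; lia.
apply: leq_trans (ltnW (size_bag h_gt0 p.1 p.2)).
rewrite cardE -(size_map f) -(size_map (anc p)); apply: uniq_leq_size.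
  by rewrite map_inj_uniq ?enum_uniq.
move=> q /mapP [v]; rewrite mem_enum inE => /andP [vb /eqP fv] ->.
by apply/mapP; exists (f v).1.
Qed.

Lemma card_Wset l x : #|Wset l x| <= 6 * h.
Proof.
apply: leq_trans (leq_card_setU _ _) _.
by have := card_Aset (l, x); have := card_Aset (l, x.+1); lia.
Qed.

Lemma Fset_level p v : v \in Fset p -> p.1 <= (f v).1.
Proof. by rewrite inE => /eqP ->; rewrite fence1 leq_addr. Qed.

Lemma mem_Fset l x v : l <= (f v).1 -> (f v).2 = (fence ((f v).1 - l) (l, x)).2 ->
  v \in Fset (l, x).
Proof.
move=> lv ev; rewrite inE; apply/eqP/eqP; rewrite -pair_eqE /pair_eq /= -ev eqxx andbT.
by rewrite fence1 /= subnKC.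
Qed.

Lemma between_mem l x v : l <= (f v).1 ->
  (fence ((f v).1 - l) (l, x)).2 <= (f v).2 <= (fence ((f v).1 - l) (l, x.+1)).2 ->
  v \in Wset l x :|: region l x.
Proof.
move=> lv /andP [lo hi]; rewrite !inE.
case: (ltngtP (fence ((f v).1 - l) (l, x)).2 (f v).2) lo => // [lo _|e _]; last first.
  by have := mem_Fset lv (esym e); rewrite inE => ->.
case: (ltngtP (f v).2 (fence ((f v).1 - l) (l, x.+1)).2) hi => // [hi _|e _].
  by rewrite ?lv ?lo ?hi /= ?orbT.
by have := mem_Fset lv e; rewrite inE => ->; rewrite !orbT.
Qed.

Lemma fence_anc l x i m : l <= i -> i <= m ->
  iter (m - i) half (fence (m - l) (l, x)).2 = (fence (i - l) (l, x)).2.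
Proof. by move=> li im; rewrite -[RHS](half_fence X (m - i)) (_ : i - l + (m - i) = m - l) //; lia. Qed.

(** A horizontal step moves by one and cannot jump over a fence. Halving is monotone and maps fences
    to themselves, so a vertical edge cannot cross one either. A neighbour above level [l] lies in
    the bag of the ancestor of [u] at level [l], whose position is [x] or [x.+1]. *)
Lemma region_closed l x u v : u \in region l x -> gE u v -> v \in Wset l x :|: region l x.
Proof.
rewrite f_adj inE => /and3P [lu lo hi].
case/or3P => [/andP [/eqP e1 hv]|/and3P [vb /eqP e2 _]|/and3P [ub /eqP e2 _]].
- apply: between_mem; rewrite -e1 //.
  by case/orP: hv => /eqP e; apply/andP; split; lia.
- have vu := bag_lt vb; have [lv|vl] := leqP l (f v).1.
    apply: between_mem => //; rewrite e2 -!(fence_anc _ lv (ltnW vu)).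
    by rewrite !iter_half_leq // ltnW.
  set z := iter ((f u).1 - l) half (f u).2.
  have zB : v \in Bset (l, z).
    rewrite inE (bag_anc lu vl vb) /= [f v]surjective_pairing e2 /anc /= /z -iterD.
    by rewrite addnC addnBA ?subnK ?(ltnW vl).
  have := iter_half_leq ((f u).1 - l) (ltnW lo); have := iter_half_leq ((f u).1 - l) (ltnW hi).
  rewrite !fence_anc // subnn /= -/z => zx xz.
  have [ez|ez] : z = x \/ z = x.+1 by lia.
    by move: zB; rewrite ez !inE => ->; rewrite !orbT.
  by move: zB; rewrite ez !inE => ->; rewrite !orbT.
have uv := bag_lt ub; have lv : l <= (f v).1 by lia.
apply: between_mem => //; apply/andP; split; rewrite leqNgt; apply/negP => /ltnW.
  move/(iter_half_leq ((f v).1 - (f u).1)); rewrite -e2 fence_anc ?(ltnW uv) //.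
  by rewrite leqNgt lo.
move/(iter_half_leq ((f v).1 - (f u).1)); rewrite -e2 fence_anc ?(ltnW uv) //.
by rewrite leqNgt hi.
Qed.

Lemma region_Fset l x y u : u \in region l x -> u \notin Fset (l, y).
Proof.
rewrite !inE => /and3P [lu lo hi]; apply/negP => /eqP /(congr1 snd) /= e.
have [yx|xy] := leqP y x.
  by have := fence_leq X ((f u).1 - l) l yx; lia.
by have := fence_leq X ((f u).1 - l) l xy; lia.
Qed.

Lemma Aset_next l x u : l < (f u).1 -> u \in Aset (l, x) -> u \in Fset (fnext (l, x)).
Proof.
move=> lu; rewrite !inE => /orP [/eqP {1}->|/andP [/bag_lt /= ul _]]; last by lia.
by rewrite -fenceSr [(fnext _).1]/= subnSK.
Qed.

Lemma region_Aset l x y u : u \in region l x -> u \notin Aset (l, y).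
Proof.
move=> ur; rewrite inE negb_or (region_Fset _ ur); rewrite !inE negb_and.
move: ur; rewrite inE => /andP [lu _].
by case: (boolP (_ \in _)) => //= /bag_lt /=; lia.
Qed.

Lemma region_disjoint l x y u : x != y -> u \in region l x -> u \notin region l y.
Proof.
move=> xy; rewrite !inE => /and3P [lu lo hi]; rewrite lu /=; apply/negP => /andP [lo' hi'].
move: xy; rewrite neq_ltn => /orP [xy|xy].
  by have := fence_leq X ((f u).1 - l) l xy; lia.
by have := fence_leq X ((f u).1 - l) l xy; lia.
Qed.

Lemma Fset_between l x y v : (fnext (l, x)).2 <= y <= (fnext (l, x.+1)).2 ->
  v \in Fset (l.+1, y) -> v \in Wset l x :|: region l x.
Proof.
move=> /andP [lo hi] vF; have /= lv := Fset_level vF.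
move: vF; rewrite inE => /eqP /(congr1 snd) /= e.
apply: between_mem; first exact: ltnW.
rewrite -(subnSK lv) !fenceSr e.
by rewrite (fence_leq X _ l.+1 lo) (fence_leq X _ l.+1 hi).
Qed.

(** The only new case is the bag: its entries are the parent of [(l.+1, y)] or belong to the
    parent's bag, and this parent has position [x] or [x.+1]. *)
Lemma Aset_between l x y v : (fnext (l, x)).2 <= y <= (fnext (l, x.+1)).2 ->
  v \in Aset (l.+1, y) -> v \in Wset l x :|: region l x.
Proof.
move=> yb; rewrite inE => /orP [|]; first exact: Fset_between yb.
rewrite inE => /andP [vb /eqP fv].
have half_y : v \in Aset (l, y./2).
  have := bag_lt vb; rewrite /= ltnS leq_eqVlt => /predU1P [vl|vl].
    rewrite inE; apply/orP; left; rewrite inE fv /anc vl subnn.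
    by rewrite subSnn.
  rewrite inE; apply/orP; right; rewrite inE.
  have := bag_anc (leqnSn l) vl vb; rewrite subSnn /= => -> /=.
  by rewrite {1}fv /anc /= subSn ?iterSr // ltnW.
case/andP: yb => /half_leq lo /half_leq hi; rewrite !half_fnext /= in lo hi.
have [e|e] : y./2 = x \/ y./2 = x.+1 by lia.
  by rewrite e in half_y; rewrite inE [in X in X || _]inE half_y.
by rewrite e in half_y; rewrite inE [in X in X || _]inE half_y orbT.
Qed.

Lemma region_between l x y v : (fnext (l, x)).2 <= y < (fnext (l, x.+1)).2 ->
  v \in region l.+1 y -> v \in Wset l x :|: region l x.
Proof.
move=> /andP [lo hi]; rewrite inE => /and3P [lv ylo yhi].
apply: between_mem; first exact: ltnW.
rewrite -(subnSK lv) !fenceSr.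
apply/andP; split; first exact: leq_trans (fence_leq X _ l.+1 lo) (ltnW ylo).
exact: leq_trans (ltnW yhi) (fence_leq X _ l.+1 hi).
Qed.

(** Induction on the number of remaining levels. The root [Q] gathers the boundary of the region and
    those of at most three subregions, each of size at most [6 * h]; this gives [24 * h]. *)
Lemma region_dec l x : rooted_dec (24 * h) (Wset l x :|: region l x) (Wset l x).
Proof.
pose N := (\max_(v : G) (f v).1).+1.
have ltN v : (f v).1 < N by rewrite ltnS; apply: (leq_bigmax v).
have [d] := ubnP (N - l); elim: d l x => // d IH l x ld.
have WK : #|Wset l x| <= 24 * h by apply: leq_trans (card_Wset l x) _; lia.
have [Nl|lN] := leqP N l.
  suff -> : region l x = set0 by rewrite setU0; apply: rooted_dec_base.
  by apply/setP => v; rewrite !inE; have := ltN v; case: leqP => //; lia.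
set p0 := (fnext (l, x)).2; set p1 := (fnext (l, x.+1)).2.
(* The two fences continue at [x.*2] and [x.+1.*2], each shifted by 0 or 1. *)
have p01 : p0 < p1 <= p0 + 3.
  by rewrite /p0 /p1 /=; case: (X (l, x)); case: (X (l, x.+1)); lia.
pose r := iota p0 (p1 - p0).
have mem_r y : (y \in r) = (p0 <= y < p1) by rewrite mem_iota subnKC //; lia.
pose Q := Wset l x :|: \bigcup_(y <- r) Wset l.+1 y.
have sub_bigcup (F : nat -> {set G}) y : y \in r -> F y \subset \bigcup_(y <- r) F y.
  by move=> yr; rewrite (big_rem y) //= subsetUl.
have QK : #|Q| <= 24 * h.
  have big s : #|\bigcup_(y <- s) Wset l.+1 y| <= size s * (6 * h).
    elim: s => [|y s IHs]; first by rewrite big_nil cards0.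
    rewrite big_cons mulSn; apply: leq_trans (leq_card_setU _ _) _.
    by apply: leq_add IHs; apply: card_Wset.
  apply: leq_trans (leq_card_setU _ _) _.
  have := big r; rewrite size_iota => bigr; have := card_Wset l x.
  have : (p1 - p0) * (6 * h) <= 3 * (6 * h) by rewrite leq_mul2r; apply/orP; right; lia.
  by move: bigr; lia.
apply: (@rooted_dec_shrink _ _ _ Q); last exact: subsetUl.
have -> : Wset l x :|: region l x = Q :|: \bigcup_(y <- r) (Wset l.+1 y :|: region l.+1 y).
  have subV y : y \in r -> Wset l.+1 y :|: region l.+1 y \subset Wset l x :|: region l x.
    rewrite mem_r => yr; apply/subsetP => v; rewrite inE => /orP [|]; last exact: region_between.
    by rewrite inE => /orP [|]; apply: Aset_between; rewrite -/p0 -/p1; lia.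
  apply/eqP; rewrite eqEsubset; apply/andP; split.
    apply/subsetP => v; rewrite inE => /orP [vW|]; first by apply/setUP; left; apply/setUP; left.
    rewrite inE => /and3P [lv lo hi].
    (* At level [l] itself nothing lies strictly between [x] and [x.+1]. *)
    have lv' : l < (f v).1.
      rewrite ltn_neqAle lv andbT; apply/negP => /eqP e; move: lo hi; rewrite -e subnn /=; lia.
    move: lo hi; rewrite -(subnSK lv') !fenceSr => lo hi.
    have [||y [y0 y1 /andP [ylo yhi]]] := @locate
        (fun y => (fence ((f v).1 - l.+1) (l.+1, y)).2) p0 p1 (f v).2; first by lia.
      by apply/andP; split; [exact: ltnW|exact: hi].
    have yr : y \in r by rewrite mem_r y0 y1.
    rewrite inE; apply/orP; right.
    apply: (subsetP (sub_bigcup (fun y => Wset l.+1 y :|: region l.+1 y) y yr)).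
    by apply: between_mem => //; rewrite ylo /= ltnW.
  have big_sub (F : nat -> {set G}) (Z : {set G}) :
      (forall y, y \in r -> F y \subset Z) -> \bigcup_(y <- r) F y \subset Z.
    move=> FZ; rewrite big_seq; elim/big_ind: _ => [|A B AZ BZ|y]; rewrite ?sub0set //.
      by rewrite subUset AZ.
    exact: FZ.
  rewrite subUset (big_sub _ _ subV) andbT subUset subsetUl /=; apply: big_sub => y yr.
  by apply: subset_trans (subV y yr); apply: subsetUl.
apply: (rooted_dec_star (W := Wset l.+1)) => //.
- exact: iota_uniq.
- by move=> y _; apply: IH; lia.
- by move=> y yr; apply: subset_trans (subsetUr _ _); apply: (sub_bigcup (Wset l.+1)).
move=> y u yr; rewrite inE => /orP [->//|ur] _.
have lu : l < (f u).1 by move: ur; rewrite inE => /andP [].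
have nW z : u \notin Wset l.+1 z.
  by rewrite inE negb_or !(region_Aset _ ur).
split; last by move=> v; apply: region_closed.
  rewrite in_setU negb_or; apply/andP; split.
    rewrite in_setU negb_or; apply/andP; split; apply/negP => /(Aset_next lu); apply/negP;
      exact: (region_Fset _ ur).
  elim/big_ind: _ => [|A B uA uB|z _]; [by rewrite inE|by rewrite inE negb_or uA|exact: nW].
move=> z _ zy; rewrite inE negb_or nW; apply: region_disjoint ur; by rewrite eq_sym.
Qed.

Hypothesis f_dom : forall v, 2 ^ (f v).1 <= (f v).2 < 2 ^ (f v).1.+1.

Lemma embedded_tw : tw_le G (24 * h).-1.
Proof.
apply: (@rooted_dec_tw _ _ (Wset 0 0 :|: Wset 0 1)); first by lia.
(* By [f_dom], positions 0 and [2 ^ m.+1] of level [m] carry no vertex. The fences from positions 0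
   and 2 therefore always turn to the even child, and enclose the whole graph. *)
have e0 m : (fence m (0, 0)).2 = 0.
  elim: m => // m IH; rewrite /= -/(fence m (0, 0)) IH.
  have := fence1 X m (0, 0); case: (fence m (0, 0)) IH => a b /= -> ->.
  case: (boolP (X _)) => // /existsP [v /eqP fv].
  by have := f_dom v; rewrite fv /= leqNgt expn_gt0.
have e2 m : (fence m (0, 2)).2 = 2 ^ m.+1.
  elim: m => // m IH; rewrite /= -/(fence m (0, 2)) IH.
  have := fence1 X m (0, 2); case: (fence m (0, 2)) IH => a b /= -> ->.
  case: (boolP (X _)) => [/existsP [v /eqP fv]|_].
    by have := f_dom v; rewrite fv /= ltnn andbF.
  by rewrite addn0 -mul2n -expnS.
have -> : setT = (Wset 0 0 :|: Wset 0 1) :|: \bigcup_(y <- [:: 0; 1]) (Wset 0 y :|: region 0 y).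
  apply/esym/eqP; rewrite -subTset; apply/subsetP => v _.
  have [||y [_ y2 /andP [lo hi]]] := @locate (fun y => (fence (f v).1 (0, y)).2) 0 2 (f v).2 => //.
    by rewrite e0 e2; have := f_dom v; lia.
  have := @between_mem 0 y v; rewrite subn0 => /(_ isT) /(_ _) vy.
  rewrite inE; apply/orP; right; rewrite !big_cons big_nil setU0 inE.
  have {vy} : v \in Wset 0 y :|: region 0 y by apply: vy; rewrite lo ltnW.
  by case: y y2 {lo hi} => [|[|]] // _ ->; rewrite ?orbT.
apply: (rooted_dec_star (W := Wset 0)) => //.
- apply: leq_trans (leq_card_setU _ _) _.
  by have := card_Wset 0 0; have := card_Wset 0 1; lia.
- by move=> y _; apply: region_dec.
- by move=> y; rewrite !inE => /orP [] /eqP ->; rewrite ?subsetUl ?subsetUr.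
move=> y u _; rewrite inE => /orP [->//|ur] _.
have nW z : u \notin Wset 0 z by rewrite inE negb_or !(region_Aset _ ur).
split; last by move=> v; apply: region_closed.
  by rewrite inE negb_or !nW.
by move=> z _ zy; rewrite inE negb_or nW; apply: region_disjoint ur; rewrite eq_sym.
Qed.

End Embedded.

(** * The class associated with a graph *)

Section Chain.
Variables (h : nat) (M : rel nat) (h_gt0 : 0 < h) (p : nat * nat).
Let s := bag h p.1 p.2.
Let c i := nth 0 (rcons s p.1) i.

Lemma chain_uniq : uniq (rcons s p.1).
Proof. by rewrite rcons_uniq bag_uniq andbT; apply/negP => /bag_lt; rewrite ltnn. Qed.

Lemma chain_bag i : i <= size s -> bag h (anc p (c i)).1 (anc p (c i)).2 = take i s.
Proof.
rewrite leq_eqVlt /anc /c nth_rcons => /predU1P [->|lt_i] /=.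
  by rewrite ltnn eqxx subnn take_size.
by rewrite lt_i bag_prefix.
Qed.

Lemma chain_level i : c i <= p.1.
Proof.
have [lt_i|ge_i] := ltnP i (size (rcons s p.1)); last by rewrite /c nth_default.
have := mem_nth 0 lt_i; rewrite -/(c i) mem_rcons inE => /predU1P [->//|].
by move/bag_lt/ltnW.
Qed.

(** By [chain_bag], the bag of the [j]-th chain node is the first [j] entries, where the [i]-th one
    has index [i]; so [up] evaluates [M i j]. Distinct levels rule out horizontal edges. *)
Lemma chain_adj i j : i < j -> j <= size s -> wadj h M (anc p (c i)) (anc p (c j)) = M i j.
Proof.
move=> ij js; have is_ : i < size s by apply: leq_trans js.
have ci : c i = nth 0 s i by rewrite /c nth_rcons is_.
have it : i < size (take j s) by rewrite size_takel.
have cit : nth 0 (take j s) i = c i by rewrite nth_take // ci.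
have in_t : c i \in take j s by rewrite -cit mem_nth.
have lt_c : c i < c j by have := chain_bag js => e; move: in_t; rewrite -e => /bag_lt.
rewrite /wadj /horiz /up !chain_bag ?(ltnW is_) //= (ltn_eqF lt_c) /=.
have -> : (c j \in take i s) = false.
  apply/negP => cjt; have /(chain_bag) e := ltnW is_.
  by move: cjt; rewrite -e => /bag_lt /=; lia.
rewrite /= in_t size_takel // -{3}cit index_uniq ?take_uniq ?bag_uniq //.
by rewrite -iterD addnC addnBA ?subnK ?(ltnW lt_c) ?chain_level ?eqxx.
Qed.

End Chain.

Section Target.
Variable H : graph.

(* Index 0 is an extra vertex joined to everything: it makes any two levels adjacent. *)
Definition pattern : rel nat := fun i j =>
  match i, j with
  | i'.+1, j'.+1 => [exists u : H, exists v : H,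
      [&& enum_rank u == i' :> nat, enum_rank v == j' :> nat & gE u v]]
  | _, _ => true
  end.

Lemma patternE (u v : H) : pattern (enum_rank u).+1 (enum_rank v).+1 = gE u v.
Proof.
apply/existsP/idP => [[u' /existsP [v' /and3P [/eqP eu /eqP ev]]]|uv].
  by rewrite (enum_rank_inj (val_inj eu)) (enum_rank_inj (val_inj ev)).
by exists u; apply/existsP; exists v; rewrite !eqxx.
Qed.

(** One index is for the extra vertex 0; the other keeps this number at least 2, so that bags of
    length one occur even for the empty graph. *)
Definition chain_size := #|H|.+2.

Lemma chain_size_gt0 : 0 < chain_size. Proof. by []. Qed.

Lemma full_chain_induced (G : graph) (f : G -> nat * nat) p : injective f ->
  (forall u v, gE u v = wadj chain_size pattern (f u) (f v)) ->
  full_chain chain_size (occupied f) p -> induced_sub H G.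
Proof.
move=> f_inj f_adj /and3P [/eqP sz Xp Xall].
pose c i := nth 0 (rcons (bag chain_size p.1 p.2) p.1) i.
have rank_le (u : H) : (enum_rank u).+1 <= size (bag chain_size p.1 p.2).
  by rewrite -ltnS sz /chain_size ltnS; apply: leq_trans (ltn_ord (enum_rank u)) _.
(* The shift by one skips the extra vertex at index 0. *)
have Xc (u : H) : exists v, f v == anc p (c (enum_rank u).+1).
  apply/existsP; have := mem_nth 0 (_ : (enum_rank u).+1 < size (rcons (bag chain_size p.1 p.2) p.1)).
  rewrite size_rcons ltnS => /(_ (rank_le u)); rewrite -/(c _) mem_rcons inE.
  case/predU1P => [->|cb]; last exact: (allP Xall).
  by rewrite anc_self.
have [e eP] := fin_all_exists Xc.
have adj_lt (u v : H) : enum_rank u < enum_rank v -> gE u v = gE (e u) (e v).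
  move=> uv; rewrite f_adj (eqP (eP u)) (eqP (eP v)) chain_adj ?ltnS //.
  by rewrite patternE.
exists e; split.
  move=> u v euv; have := eP u; rewrite euv (eqP (eP v)) => /eqP [/eqP + _].
  rewrite nth_uniq ?chain_uniq ?size_rcons ?ltnS ?rank_le // eqSS => /eqP uv.
  by apply: enum_rank_inj; apply: val_inj.
move=> u v; case: (ltngtP (enum_rank u) (enum_rank v)) => [uv|vu|uv].
- exact: adj_lt.
- by rewrite gE_sym adj_lt // gE_sym.
by rewrite (enum_rank_inj (val_inj uv)) !gE_irr.
Qed.

(** The finite induced subgraphs of one infinite wheel. The bounds on positions select the binary
    tree rooted at [(0, 1)] in the forest. *)
Definition wheel_class : graph_class := fun G => exists f : G -> nat * nat,
  [/\ injective f, forall v, 2 ^ (f v).1 <= (f v).2 < 2 ^ (f v).1.+1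
    & forall u v, gE u v = wadj chain_size pattern (f u) (f v)].

Lemma wheel_class_hereditary : hereditary wheel_class.
Proof.
move=> G G' [f [f_inj f_dom f_adj]] [g [g_inj g_adj]].
exists (f \o g); split=> [|v|u v]; [exact: inj_comp|exact: f_dom|].
by rewrite g_adj f_adj.
Qed.

Lemma wheel_class_sparse : weakly_sparse wheel_class.
Proof. by exists chain_size.+2 => G [f [f_inj _ f_adj]]; apply: no_Ktt f_adj. Qed.

Lemma wheel_class_Hfree_tw : bounded_tw (fun G => wheel_class G /\ Hfree H G).
Proof.
exists (24 * chain_size).-1 => G [[f [f_inj f_dom f_adj]] GH].
apply: (embedded_tw chain_size_gt0 f_inj f_adj) => // p.
by apply/negP => /(full_chain_induced f_inj f_adj).
Qed.

(** * The first levels of the wheel have large treewidth *)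

Section Truncation.
Variable n : nat.

Definition wvertex := {p : 'I_n * 'I_(2 ^ n) | 2 ^ p.1 <= p.2 < 2 ^ p.1.+1}.
Definition wpos (v : wvertex) : nat * nat := (nat_of_ord (val v).1, nat_of_ord (val v).2).
Definition wedge : rel wvertex := fun u v => wadj chain_size pattern (wpos u) (wpos v).

Lemma wedge_sym : symmetric wedge. Proof. by move=> u v; apply: wadj_sym. Qed.

Lemma wedge_irr : irreflexive wedge.
Proof.
move=> u; apply/negP; rewrite /wedge /wadj /horiz /up; set p := wpos u.
by case/or3P => [/andP [_ /orP [] /eqP]|/and3P [/bag_lt]|/and3P [/bag_lt]]; lia.
Qed.

Definition wheel := Graph wedge_sym wedge_irr.

Lemma wpos_inj : injective wpos.
Proof.
move=> [[a b] ?] [[a' b'] ?] [/= ea eb]; apply: val_inj => /=.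
by congr pair; apply: val_inj.
Qed.

Lemma wpos_onto l x : l < n -> 2 ^ l <= x < 2 ^ l.+1 -> exists v, wpos v = (l, x).
Proof.
move=> ln dom; have xn : x < 2 ^ n.
  by case/andP: dom => _ xl; apply: leq_trans xl _; rewrite leq_exp2l.
by exists (Sub (Ordinal ln, Ordinal xn) dom).
Qed.

Lemma wheel_in_class : wheel_class wheel.
Proof. by exists wpos; split=> //; [exact: wpos_inj|case]. Qed.

(** The leftmost branch only takes even children, so nothing ever enters its bag. *)
Lemma spine_bag l : bag chain_size l (2 ^ l) = [::].
Proof. by elim: l => //= l IH; rewrite expnS mul2n odd_double doubleK. Qed.

(* A descendant at level [i + 1 + k] whose bag is the leftmost node of level [i]. *)
Fixpoint descent i k := if k is k'.+1 then (descent i k').*2 else (2 ^ i).*2.+1.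

Lemma descentP i k : let y := descent i k in
  [/\ bag chain_size (i.+1 + k) y = [:: i], iter k.+1 half y = 2 ^ i
    & 2 ^ (i.+1 + k) <= y < 2 ^ (i.+1 + k).+1].
Proof.
elim: k => [|k [IHb IHh IHd]].
  rewrite addn0 /= odd_double uphalf_double spine_bag /=; split=> //.
  by rewrite !expnS; have := expn_gt0 2 i; lia.
rewrite addnS; split; rewrite ?[iter k.+2 _ _]iterSr /= ?odd_double ?doubleK //.
move: IHd; rewrite (expnS _ (i.+1 + k).+1) (expnS _ (i.+1 + k)); lia.
Qed.

Lemma wheel_tw k : tw_le wheel k -> n <= k.+1.
Proof.
pose lev (v : wheel) := (val v).1.
apply: (@clique_minor_tw wheel n lev).
- set e := rel_of_simpl _.
  have csym : connect_sym e.
    by apply: sym_connect_sym => u v; rewrite /e /= wedge_sym eq_sym.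
  (* A level is a path: walk left to its first node. *)
  have toS (l : 'I_n) w : wpos w = (nat_of_ord l, 2 ^ l) ->
      forall d u, wpos u = (nat_of_ord l, 2 ^ l + d) -> connect e u w.
    move=> ew; elim=> [|d IH] u eu.
      by rewrite (@wpos_inj u w) ?connect0 // eu ew addn0.
    have ud : 2 ^ l <= 2 ^ l + d.+1 < 2 ^ l.+1.
      by have := valP u; have [-> ->] := eu.
    have [|u' eu'] := @wpos_onto l (2 ^ l + d) (ltn_ord l); first by lia.
    apply: (@connect_trans _ _ u'); last exact: IH.
    apply: connect1; rewrite /e /= /wedge eu eu' /wadj /horiz /= eqxx -(addnS _ d) eqxx orbT /=.
    apply/eqP; apply: val_inj; move: eu eu'; rewrite /wpos => -[e1 _] [e2 _].
    exact: etrans e1 (esym e2).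
  have dec (v : wheel) : wpos v = (nat_of_ord (lev v), 2 ^ lev v + ((val v).2 - 2 ^ lev v)).
    by rewrite subnKC //; case/andP: (valP v).
  move=> u v luv.
  have [|w ew] := @wpos_onto (lev u) (2 ^ lev u) (ltn_ord _).
    by rewrite leqnn ltn_exp2l /=.
  apply: (connect_trans (toS _ _ ew _ _ (dec u))); rewrite csym.
  by apply: (toS _ _ ew _ _); rewrite luv; apply: dec.
- move=> i; have [|w ew] := @wpos_onto i (2 ^ i) (ltn_ord _).
    by rewrite leqnn ltn_exp2l /=.
  by exists w; apply: val_inj; case: ew.
have adj (i j : 'I_n) : i < j -> exists u v, [/\ lev u = i, lev v = j & wedge u v].
  move=> ij; have [|u eu] := @wpos_onto i (2 ^ i) (ltn_ord _).
    by rewrite leqnn ltn_exp2l /=.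
  have [] := descentP i (j - i.+1); rewrite subnKC // subnSK // => yb yh yd.
  have [v ev] := wpos_onto (ltn_ord j) yd.
  exists u, v; split; [by apply: val_inj; case: eu|by apply: val_inj; case: ev|].
  (* The bag of [v] consists of [u] alone, so adjacency is [pattern 0 1], true because index 0 is
     the extra vertex. *)
  rewrite /wedge eu ev /wadj /up /= yb yh !inE !eqxx /=.
by apply/or3P; constructor 3; rewrite eqxx.
move=> i j; rewrite neq_ltn => /orP [/adj //|/adj [u [v [ui vj uv]]]].
by exists v, u; rewrite gE_sym.
Qed.

End Truncation.

Lemma wheel_class_unbounded : ~ bounded_tw wheel_class.
Proof. by case=> k /(_ _ (wheel_in_class k.+2)) /wheel_tw; rewrite ltnn. Qed.

End Target.

Theorem theorem1p1 :
  forall H : graph,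
  exists C : graph_class,
    hereditary C /\ weakly_sparse C /\ ~ bounded_tw C /\
    bounded_tw (fun G => C G /\ Hfree H G).
Proof.
move=> H; exists (wheel_class H).
split; first exact: wheel_class_hereditary.
split; first exact: wheel_class_sparse.
by split; [exact: wheel_class_unbounded|exact: wheel_class_Hfree_tw].
Qed.
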